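(* Let $N\ge 2$ and let positive Patankar-weight denominators $\sigma_1,\dots,\sigma_N$ be given. The one-stage modified Patankar-Runge-Kutta scheme $$y_i^{n+1}=y_i^n+\Delta t\sum_{j=1}^N\Bigl(p_{ij}(\mathbf y^n)\frac{y_j^{n+1}}{\sigma_j}-d_{ij}(\mathbf y^n)\frac{y_i^{n+1}}{\sigma_i}\Bigr),\qquad i=1,\dots,N,$$ is first order accurate if and only if $$\sigma_i=y_i^n+\mathcal O(\Delta t),\qquad i=1,\dots,N.$$
   Context: A production-destruction system (PDS) is an ODE system $y_i'(t)=P_i(\mathbf y(t))-D_i(\mathbf y(t))$, $i=1,\dots,N$, with $P_i(\mathbf y)=\sum_{j=1}^N p_{ij}(\mathbf y)$, $D_i(\mathbf y)=\sum_{j=1}^N d_{ij}(\mathbf y)$, where $p_{ij},d_{ij}\ge 0$ are defined for $\mathbf y\ge 0$ (componentwise) and are twice continuously differentiable on $(0,\infty)^N$. The PDS is positive if positive initial values imply positive solutions for all $t>0$. It is fully conservative if $p_{ij}(\mathbf y)=d_{ji}(\mathbf y)$ and $p_{ii}(\mathbf y)=d_{ii}(\mathbf y)=0$ for all $i,j$ and $\mathbf y\ge0$. All PDS considered are positive and fully conservative. The Patankar-weight denominators are prescribed by one rule for all PDS: $\sigma_i=\sigma_i(\Delta t,\mathbf y^n)>0$ for all $\Delta t>0$ and all $\mathbf y^n\in(0,\infty)^N$; in particular $\sigma_i$ does not depend on $y_i^{n+1}$, and $\mathbf y^{n+1}$ is obtained from a linear system. First order accurate means: for every positive fully conservative PDS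 with $N$ constituents and every $\mathbf y^n\in(0,\infty)^N$, if $\mathbf y(t)$ is the solution with $\mathbf y(t^n)=\mathbf y^n$ and $t^{n+1}=t^n+\Delta t$, then $y_i^{n+1}-y_i(t^{n+1})=\mathcal O(\Delta t^2)$ as $\Delta t\to0$ for $i=1,\dots,N$. The condition $\sigma_i=y_i^n+\mathcal O(\Delta t)$ is understood for every $\mathbf y^n\in(0,\infty)^N$. Landau symbols refer to $\Delta t\to0^+$ with the PDS and $\mathbf y^n$ fixed. *)

(* Defs.v *)
From HB Require Import structures.
From mathcomp Require Import all_boot all_order all_algebra.
From mathcomp Require Import all_classical all_reals all_analysis.

Set Implicit Arguments.
Unset Strict Implicit.
Unset Printing Implicit Defensive.

Import Order.TTheory GRing.Theory Num.Theory.
Import numFieldNormedType.Exports.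

Local Open Scope classical_set_scope.
Local Open Scope ring_scope.

Section PDS.
Context {R : realType} {N : nat}.

Definition pos_vec (y : 'rV[R]_N) : Prop := forall i, 0 < y 0 i.
Definition nneg_vec (y : 'rV[R]_N) : Prop := forall i, 0 <= y 0 i.

Definition partial (k : 'I_N) (f : 'rV[R]_N -> R) : 'rV[R]_N -> R :=
  'D_(delta_mx 0 k) f.

(* The orthant is open, so continuity and derivatives at its points do not
   see the values of f outside it. *)
Definition C2_pos_orthant (f : 'rV[R]_N -> R) : Prop :=
  forall y, pos_vec y ->
    {for y, continuous f} /\
    forall k, [/\ derivable f y (delta_mx 0 k),
                  {for y, continuous (partial k f)} &
      forall l, derivable (partial k f) y (delta_mx 0 l) /\
                {for y, continuous (partial l (partial k f))}].

(* p and d are total functions, but only their values on nonnegative vectors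
   are ever constrained or used. *)
Record pds : Type := Pds {
  production : 'I_N -> 'I_N -> 'rV[R]_N -> R;
  destruction : 'I_N -> 'I_N -> 'rV[R]_N -> R;
  production_ge0 : forall i j y, nneg_vec y -> 0 <= production i j y;
  destruction_ge0 : forall i j y, nneg_vec y -> 0 <= destruction i j y;
  production_C2 : forall i j, C2_pos_orthant (production i j);
  destruction_C2 : forall i j, C2_pos_orthant (destruction i j) }.

Definition pds_rhs (S : pds) (i : 'I_N) (y : 'rV[R]_N) : R :=
  \sum_j production S i j y - \sum_j destruction S i j y.

(* Classical solution on [t0, +oo[, with a one-sided derivative at t0. *)
Definition pds_solution (S : pds) (t0 : R) (y : R -> 'rV[R]_N) : Prop :=
  (forall t, t0 <= t -> nneg_vec (y t)) /\
  forall i,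
    (h^-1 * (y (t0 + h) 0 i - y t0 0 i) @[h --> 0^'+] --> pds_rhs S i (y t0)) /\
    forall t, t0 < t ->
      is_derive t (1 : R) (fun s => y s 0 i) (pds_rhs S i (y t)).

Definition pds_positive (S : pds) : Prop :=
  forall y0, pos_vec y0 ->
    (exists y, pds_solution S 0 y /\ y 0 = y0) /\
    (forall y, pds_solution S 0 y -> y 0 = y0 ->
       forall t, 0 < t -> pos_vec (y t)).

Definition fully_conservative (S : pds) : Prop :=
  forall i j y, nneg_vec y ->
    [/\ production S i j y = destruction S j i y, production S i i y = 0 & destruction S i i y = 0].

(* sigma dt yn is the vector of Patankar-weight denominators; it does not take
   the system as an argument, the same rule being used for all systems. *)
Definition MPRK_step (sigma : R -> 'rV[R]_N -> 'rV[R]_N) (S : pds) (dt : R)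
    (yn ynext : 'rV[R]_N) : Prop :=
  forall i, ynext 0 i = yn 0 i + dt * \sum_j
    (production S i j yn * (ynext 0 j / sigma dt yn 0 j)
     - destruction S i j yn * (ynext 0 i / sigma dt yn 0 i)).

Definition first_order_accurate (sigma : R -> 'rV[R]_N -> 'rV[R]_N) : Prop :=
  forall S : pds, pds_positive S -> fully_conservative S ->
  forall (tn : R) (yn : 'rV[R]_N), pos_vec yn ->
  forall y : R -> 'rV[R]_N, pds_solution S tn y -> y tn = yn ->
  forall ynext : R -> 'rV[R]_N,
    (forall dt, 0 < dt -> MPRK_step sigma S dt yn (ynext dt)) ->
  forall i, (fun dt : R => ynext dt 0 i - y (tn + dt) 0 i)
              =O_ (0^'+) (fun dt : R => dt ^+ 2).

End PDS.

Arguments pds : clear implicits.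

(* Main.v *)
Require Import Defs.
From HB Require Import structures.
From mathcomp Require Import all_boot all_order all_algebra.
From mathcomp Require Import all_classical all_reals all_analysis.
From mathcomp Require Import ring lra.

Set Implicit Arguments.
Unset Strict Implicit.
Unset Printing Implicit Defensive.

Import Order.TTheory GRing.Theory Num.Theory.
Import numFieldNormedType.Exports.

Local Open Scope classical_set_scope.
Local Open Scope ring_scope.

(** Both the exact solution and the numerical one are compared with the explicit
    Euler value [yn + dt * F yn], where [F] is the right-hand side of the system.

    The exact solution always satisfies [y (tn + dt) = yn + dt * F yn + O(dt^2)]
    ([solution_expansion]): its difference quotient at [tn] converges, so it is
    within [O(dt)] of [yn]; a [C^2] right-hand side is Lipschitz near [yn]; the
    mean value theorem concludes.

    If [sigma_i = yn_i + O(dt)], put [w_i = ynext_i / sigma_i].  The scheme reads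
    [sigma_i w_i = yn_i + dt * (linear form in w)].  For small [dt] the diagonal
    [sigma] dominates, so [w] is bounded; feeding this back gives
    [ynext - yn = O(dt)], hence [w_i = 1 + O(dt)], and putting that into the
    scheme once more gives [ynext = yn + dt * F yn + O(dt^2)]
    ([MPRK_expansion]).

    Conversely, one test system per index [i] is enough: the linear exchange
    [y_i' = - y_i], [y_j' = y_i] for some [j != i].  It is positive and
    conservative, it can be solved in closed form, and its scheme yields
    [sigma_i (yn_i - u) = dt * yn_i * u] for [u = ynext_i].  First order accuracy
    says [u = yn_i - dt * yn_i + O(dt^2)]; solving for [sigma_i] then gives
    [sigma_i = yn_i + O(dt)] ([denominator_bound]). *)

(** * Local Lipschitz estimates *)

Section LocalLipschitz.
Context {R : realType}.

(** Along a line only a directional derivative is required, so no total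
    differentiability has to be derived from the partial derivatives. *)
Lemma is_derive_line (V : normedModType R) (f : V -> R) (x v : V) (t : R) :
  derivable f (x + t *: v) v ->
  is_derive t (1 : R) (fun s => f (x + s *: v)) ('D_v f (x + t *: v)).
Proof.
have E : (fun h : R => h^-1 *: (((fun s => f (x + s *: v)) \o shift t) (h *: 1)
                              - f (x + t *: v)))
       = (fun h : R => h^-1 *: ((f \o shift (x + t *: v)) (h *: v)
                              - f (x + t *: v))).
  apply/funext => h /=; congr (_ *: (f _ - _)).
  by rewrite /GRing.scale/= mulr1 -/(GRing.scale _ _) scalerDl addrCA addrA.
by move=> df; split; rewrite /derivable /derive E.
Qed.

Lemma mean_value_le (g dg : R -> R) (c L : R) :
  (forall t, `|t| <= `|c| -> is_derive t (1 : R) g (dg t)) ->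
  (forall t, `|t| <= `|c| -> `|dg t| <= L) ->
  `|g c - g 0| <= L * `|c|.
Proof.
move=> g_dg dg_le.
have mvt (a b : R) : a <= b -> (forall t, a <= t <= b -> `|t| <= `|c|) ->
    `|g b - g a| <= L * (b - a).
  move=> ab abc.
  have [t tab||t] := @MVT_segment R g dg a b ab.
  - apply: g_dg; apply: abc; move: tab.
    by rewrite in_itv/= => /andP[/ltW-> /ltW->].
  - apply: derivable_within_continuous => t; rewrite in_itv/= => /abc /g_dg dt.
    exact: ex_derive.
  - rewrite in_itv/= => /abc tc ->.
    rewrite normrM (ger0_norm (x := b - a)) ?subr_ge0//.
    by rewrite ler_wpM2r ?subr_ge0// dg_le.
have [c0|c0] := leP 0 c.
- have := @mvt 0 c c0; rewrite subr0 (ger0_norm c0).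
  apply => t /andP[t0 tc].
  by rewrite ger0_norm.
- have := @mvt c 0 (ltW c0); rewrite distrC sub0r (ltr0_norm c0).
  apply => t /andP[tc t0].
  by rewrite ler0_norm// lerN2.
Qed.

Context {N : nat}.
Implicit Types (f g : 'rV[R]_N -> R) (y z : 'rV[R]_N).

(** Lipschitz at the single point [y], for the sup norm: [D] is any bound of the
    distance from [z] to [y], so that no norm has to be computed. *)
Definition lipschitz_at f y :=
  exists2 K : R, 0 <= K & exists2 e : R, 0 < e &
    forall z D, D < e -> (forall i, `|z 0 i - y 0 i| <= D) ->
      `|f z - f y| <= K * D.

Lemma nbhs_coord y (P : set 'rV[R]_N) : nbhs y P ->
  exists2 e : R, 0 < e & forall z, (forall i, `|z 0 i - y 0 i| < e) -> P z.
Proof.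
move=> /nbhs_ballP[e /= e0 eP]; exists e => // z zy; apply: eP.
by split => // i j; rewrite ord1 /ball /= distrC.
Qed.

Lemma pos_vec_near y : pos_vec y -> \forall z \near y, pos_vec z.
Proof.
move=> y0.
apply: (@filter_forall _ _ (fun i z => 0 < z 0 i) _ (nbhs_filter y)) => i.
exact: (@coord_continuous R 1 N 0 i y _ (lt_nbhsr (y0 i))).
Qed.

(** Go from [y] to [z] by changing one coordinate at a time. The path stays in
    a box around [y] on which every partial derivative is bounded by [L], so by
    the mean value theorem each of the [N] steps costs at most [L * D]. *)
Lemma C2_lipschitz_at f y :
  C2_pos_orthant f -> pos_vec y -> lipschitz_at f y.
Proof.
move=> f2 y0.
pose L := \sum_k (`|partial k f y| + 1).
have L0 : 0 <= L by apply: sumr_ge0 => k _; rewrite addr_ge0.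
have : \forall z \near y, pos_vec z /\ forall k, `|partial k f z| <= L.
  apply: (@filterI _ _ (nbhs_filter y)); first exact: pos_vec_near.
  apply: (@filter_forall _ _ _ _ (nbhs_filter y)) => k.
  have [_ /(_ k)[_ ck _]] := f2 _ y0.
  have := @cvgr_norm_le _ _ _ _ (nbhs_filter y) _ _ ck _
    (ltr_pwDr ltr01 (lexx _)).
  apply: (@filterS _ _ (nbhs_filter y)) => z /le_trans; apply.
  rewrite /L (bigD1 k)//= lerDl.
  by apply: sumr_ge0 => j _; rewrite addr_ge0.
move=> /nbhs_coord[e e0 near_y].
exists (N%:R * L); first exact: mulr_ge0.
exists e => // z D De zD.
(* The path: the first m coordinates have already been moved to those of z. *)
pose w m : 'rV[R]_N := \row_i (if (i < m)%N then z 0 i else y 0 i).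
suff H m : (m <= N)%N -> `|f (w m) - f y| <= m%:R * L * D.
  have -> : z = w N by apply/rowP => i; rewrite mxE ltn_ord.
  exact: H.
elim: m => [_|m IH mN].
  have -> : w 0 = y by apply/rowP => i; rewrite mxE ltn0.
  by rewrite subrr normr0 !mul0r.
have := IH (ltnW mN); pose k := Ordinal mN.
pose c := z 0 k - y 0 k.
have wS : w m.+1 = w m + c *: delta_mx 0 k.
  apply/rowP => i; rewrite !mxE eqxx/= ltnS leq_eqVlt -(inj_eq val_inj)/=.
  case: eqP => [im|_] /=; last by rewrite mulr0 addr0.
  have -> : i = k by apply: val_inj.
  by rewrite ltnn mulr1 /c addrC subrK.
have close t i : `|t| <= `|c| -> `|(w m + t *: delta_mx 0 k) 0 i - y 0 i| < e.
  move=> tc; apply: le_lt_trans De; rewrite !mxE eqxx/= -(inj_eq val_inj)/=.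
  have D0 : 0 <= D := le_trans (normr_ge0 _) (zD k).
  case: eqP => [im|_] /=; last first.
    by rewrite mulr0 addr0; case: ifP => // _; rewrite subrr normr0.
  by rewrite im ltnn mulr1 addrAC subrr add0r (le_trans tc)// zD.
rewrite wS => IHm.
have := @mean_value_le (fun t => f (w m + t *: delta_mx 0 k))
  (fun t => partial k f (w m + t *: delta_mx 0 k)) c L.
rewrite scale0r addr0 => step.
have {}step : `|f (w m + c *: delta_mx 0 k) - f (w m)| <= L * `|c|.
  apply: step => t tc; have [p0 pL] := near_y _ (fun i => close t i tc) => //.
  by apply: is_derive_line; have [_ /(_ k)[]] := f2 _ p0.
have {}step : `|f (w m + c *: delta_mx 0 k) - f (w m)| <= L * D.
  apply: le_trans step _; exact: ler_wpM2l (zD k).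
apply: le_trans (ler_distD (f (w m)) _ _) _.
apply: le_trans (lerD step IHm) _.
by rewrite -natr1; lra.
Qed.

Lemma lipschitz_atB f g y : lipschitz_at f y -> lipschitz_at g y ->
  lipschitz_at (fun z => f z - g z) y.
Proof.
move=> [K K0 [e e0 fe]] [L L0 [d d0 gd]].
exists (K + L); first exact: addr_ge0.
exists (Num.min e d) => [|z D]; first by rewrite lt_min e0.
rewrite lt_min => /andP[/fe{}fe /gd{}gd] zD.
have := fe _ zD; have := gd _ zD; rewrite mulrDl.
rewrite !ler_norml; lra.
Qed.

Lemma lipschitz_at_sum (I : Type) (r : seq I) (F : I -> 'rV[R]_N -> R) y :
  (forall i, lipschitz_at (F i) y) ->
  lipschitz_at (fun z => \sum_(i <- r) F i z) y.
Proof.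
move=> Fy; elim: r => [|i r [K K0 [e e0 fe]]].
  by exists 0 => //; exists 1 => // z D _ _; rewrite !big_nil subrr normr0 mul0r.
have [L L0 [d d0 gd]] := Fy i.
exists (K + L); first exact: addr_ge0.
exists (Num.min e d) => [|z D]; first by rewrite lt_min e0.
rewrite lt_min => /andP[/fe{}fe /gd{}gd] zD.
have := fe _ zD; have := gd _ zD; rewrite mulrDl !big_cons.
rewrite !ler_norml; lra.
Qed.

End LocalLipschitz.

(** * Expansion of the exact solution *)

Section SolutionExpansion.
Context {R : realType} {N : nat}.
Implicit Types S : pds R N.

Lemma pds_rhs_lipschitz_at S i (y : 'rV[R]_N) :
  pos_vec y -> lipschitz_at (pds_rhs S i) y.
Proof.
move=> y0; apply: lipschitz_atB; apply: lipschitz_at_sum => j;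
  apply: C2_lipschitz_at => //; [exact: production_C2|exact: destruction_C2].
Qed.

(** The one-sided difference quotients at [t0] converge, hence are bounded. *)
Lemma solution_near_start S t0 (y : R -> 'rV[R]_N) : pds_solution S t0 y ->
  exists2 C : R, 0 <= C &
    \forall h \near 0^'+, forall j, `|y (t0 + h) 0 j - y t0 0 j| <= C * h.
Proof.
move=> [_ y_ode]; pose F j := pds_rhs S j (y t0).
pose C := \sum_j (`|F j| + 1).
exists C; first by apply: sumr_ge0 => j _; rewrite addr_ge0.
apply: filter_forall => j; have [yj _] := y_ode j.
have {}yj : \forall h \near 0^'+,
    `|h^-1 * (y (t0 + h) 0 j - y t0 0 j)| <= `|F j| + 1.
  by apply: (cvgr_norm_le _ yj); rewrite ltrDl.
near=> h; have h0 : 0 < h by near: h; exact: nbhs_right_gt.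
have : `|h^-1 * (y (t0 + h) 0 j - y t0 0 j)| <= `|F j| + 1.
  by near: h.
rewrite normrM normfV (gtr0_norm h0) mulrC ler_pdivrMr// => /le_trans; apply.
rewrite ler_pM2r// /C (bigD1 j)//= lerDl.
by apply: sumr_ge0 => k _; rewrite addr_ge0.
Unshelve. all: by end_near. Qed.

Lemma solution_continuous S t0 (y : R -> 'rV[R]_N) i a : pds_solution S t0 y ->
  t0 < a -> {within `[t0, a], continuous (fun t => y t 0 i)}.
Proof.
move=> yS t0a; have [_ /(_ i)[_ dy]] := yS.
have cy t : t0 < t -> {for t, continuous (fun s => y s 0 i)}.
  move=> /dy yt; apply/differentiable_continuous/derivable1_diffP.
  exact: ex_derive.
apply/continuous_within_itvP => //; split.
- by move=> t; rewrite in_itv/= => /andP[/cy].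
- have [C C0 yC] := solution_near_start yS.
  apply/cvgrPdist_lt => e e0; apply/nbhs_right0P.
  have eC : 0 < e / (C + 1) by rewrite divr_gt0// ltr_wpDl.
  near=> h; rewrite distrC.
  have h0 : 0 < h by near: h; exact: nbhs_right_gt.
  have yh : forall j, `|y (t0 + h) 0 j - y t0 0 j| <= C * h by near: h.
  apply: (le_lt_trans (yh i)).
  apply: (@le_lt_trans _ _ ((C + 1) * h)); first by rewrite ler_pM2r// lerDl.
  rewrite mulrC -ltr_pdivlMr; first by near: h; exact: nbhs_right_lt.
  by rewrite ltr_wpDl.
- by apply: cvg_at_left_filter; exact: cy.
Unshelve. all: by end_near. Qed.

(** By the mean value theorem the increment is [h * F_i (y t)] for an
    intermediate [t], and [F_i (y t)] differs from [F_i (y t0)] by at most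
    [K * (C * h)], as [y t] is within [C * h] of [y t0]. *)
Lemma solution_expansion S t0 (y : R -> 'rV[R]_N) i : pds_solution S t0 y ->
  pos_vec (y t0) ->
  exists2 C : R, 0 <= C & \forall h \near 0^'+,
    `|y (t0 + h) 0 i - y t0 0 i - h * pds_rhs S i (y t0)| <= C * h ^+ 2.
Proof.
move=> yS y0; have [_ /(_ i)[_ dy]] := yS.
have [K K0 [e e0 lipF]] := @pds_rhs_lipschitz_at S i _ y0.
have [C C0] := solution_near_start yS.
move=> [d /= d0 yC].
exists (K * C); first exact: mulr_ge0.
near=> h.
have h0 : 0 < h by near: h; exact: nbhs_right_gt.
have [|||t] := @MVT R (fun t => y t 0 i) (fun t => pds_rhs S i (y t))
  t0 (t0 + h).
- by rewrite ltrDl.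
- by move=> t; rewrite in_itv/= => /andP[/dy].
- by apply: solution_continuous yS _; rewrite ltrDl.
rewrite in_itv/= => /andP[t0t th] ->; rewrite (addrC t0) addrK.
rewrite (mulrC _ h) -mulrBr normrM gtr0_norm//.
have -> : K * C * h ^+ 2 = h * (K * (C * h)) by ring.
rewrite ler_pM2l//; apply: lipF => [|j].
  rewrite (@le_lt_trans _ _ ((C + 1) * h))// ?ler_pM2r ?lerDl//.
  rewrite mulrC -ltr_pdivlMr; last by rewrite ltr_wpDl.
  by near: h; apply: nbhs_right_lt; rewrite divr_gt0// ltr_wpDl.
rewrite (_ : t = t0 + (t - t0)); last by rewrite addrC subrK.
apply: (@le_trans _ _ (C * (t - t0))); last by rewrite ler_wpM2l//; lra.
apply: yC; last by rewrite subr_gt0.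
rewrite /= sub0r normrN gtr0_norm ?subr_gt0//.
have hd : h < d by near: h; exact: nbhs_right_lt.
lra.
Unshelve. all: by end_near. Qed.

End SolutionExpansion.

(** * Expansion of the numerical solution *)

Section SchemeExpansion.
Context {R : realType} {N : nat}.

Lemma bigO_at_rightP (f g : R -> R) :
  f =O_ (0^'+) g <->
  exists2 C : R, 0 < C & \forall h \near 0^'+, `|f h| <= C * `|g h|.
Proof. exact: eqO_exP. Qed.

(** The bound on the ratios [w_j = ynext_j / sigma_j] is obtained from the sum
    [V] of their absolute values. As [sigma_j >= yn_j / 2], the scheme gives
    [|w_j| <= 2 + h * V * (2 * A_j / yn_j)]; summing, [V <= 2 * N + h * B * V],
    so that [V <= 4 * N] once [h * B <= 1 / 2]. *)
Lemma MPRK_expansion (sigma : R -> 'rV[R]_N -> 'rV[R]_N) (S : pds R N)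
    (yn : 'rV[R]_N) (ynext : R -> 'rV[R]_N) (c : 'I_N -> R) i :
  pos_vec yn ->
  (forall j, \forall h \near 0^'+, `|sigma h yn 0 j - yn 0 j| <= c j * h) ->
  (forall h, 0 < h -> MPRK_step sigma S h yn (ynext h)) ->
  exists2 C : R, 0 <= C & \forall h \near 0^'+,
    `|ynext h 0 i - yn 0 i - h * pds_rhs S i yn| <= C * h ^+ 2.
Proof.
move=> y0 sigmaP stepP.
have yge0 : nneg_vec yn by move=> j; exact: ltW.
pose A j := \sum_k (production S j k yn + destruction S j k yn).
have term_ge0 j k : 0 <= production S j k yn + destruction S j k yn.
  by rewrite addr_ge0 ?production_ge0 ?destruction_ge0.
have A0 j : 0 <= A j by exact: sumr_ge0.
(* The scheme evaluates this linear form at w; the explicit Euler step would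
   evaluate it at the constant vector 1. *)
have flux_le j (v : 'I_N -> R) B : (forall k, `|v k| <= B) ->
    `|\sum_k (production S j k yn * v k - destruction S j k yn * v j)|
      <= A j * B.
  move=> vB; rewrite (le_trans (ler_norm_sum _ _ _))// /A mulr_suml.
  apply: ler_sum => k _; rewrite (le_trans (ler_normB _ _))// !normrM mulrDl.
  rewrite (ger0_norm (production_ge0 _ _ _ yge0)).
  rewrite (ger0_norm (destruction_ge0 _ _ _ yge0)).
  by rewrite lerD// ler_wpM2l ?production_ge0 ?destruction_ge0.
pose B := \sum_j 2 * A j / yn 0 j.
have B0 : 0 <= B.
  by apply: sumr_ge0 => j _; rewrite divr_ge0 ?mulr_ge0// ltW.
pose W : R := 4 * N%:R.
pose D := \sum_j `|(A j * W + c j) * 2 / yn 0 j|.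
have sigma_near j : \forall h \near 0^'+,
    `|sigma h yn 0 j - yn 0 j| <= yn 0 j / 2.
  near=> h.
  have h0 : 0 < h by near: h; exact: nbhs_right_gt.
  have /le_trans : `|sigma h yn 0 j - yn 0 j| <= c j * h.
    by near: h; exact: sigmaP.
  apply; apply: (@le_trans _ _ ((`|c j| + 1) * h)).
    by rewrite ler_pM2r//; have := ler_norm (c j); lra.
  rewrite mulrC -ler_pdivlMr; last by rewrite ltr_wpDl.
  by near: h; apply: nbhs_right_le; rewrite !divr_gt0// ltr_wpDl.
exists (A i * D); first by rewrite mulr_ge0 ?sumr_ge0.
near=> h.
have h0 : 0 < h by near: h; exact: nbhs_right_gt.
have hB : h * B <= 1 / 2.
  apply: (@le_trans _ _ (h * (B + 1))); first by rewrite ler_pM2l// lerDl.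
  rewrite -ler_pdivlMr; last by rewrite ltr_wpDl.
  by near: h; apply: nbhs_right_le; rewrite !divr_gt0// ltr_wpDl.
have sc j : `|sigma h yn 0 j - yn 0 j| <= c j * h.
  move: j; near: h; apply: filter_forall => j; exact: sigmaP.
have s_half j : yn 0 j / 2 <= sigma h yn 0 j.
  have : `|sigma h yn 0 j - yn 0 j| <= yn 0 j / 2.
    by move: j; near: h; apply: filter_forall => j; exact: sigma_near.
  rewrite ler_norml; lra.
have s0 j : 0 < sigma h yn 0 j by apply: lt_le_trans (s_half j); rewrite divr_gt0.
pose w j := ynext h 0 j / sigma h yn 0 j.
have step j : ynext h 0 j - yn 0 j =
    h * \sum_k (production S j k yn * w k - destruction S j k yn * w j).
  by rewrite (stepP h h0 j) addrC addKr.
have wE j : ynext h 0 j = sigma h yn 0 j * w j.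
  by rewrite /w mulrC divfK// gt_eqF.
pose V := \sum_j `|w j|.
have wV j : `|w j| <= V by rewrite /V (bigD1 j)//= lerDl sumr_ge0.
have V0 : 0 <= V by exact: sumr_ge0.
have dyV j : `|ynext h 0 j - yn 0 j| <= h * (A j * V).
  by rewrite step normrM gtr0_norm// ler_pM2l// flux_le.
(* The a priori bound, absorbing h * B * V into the left-hand side. *)
have VW : V <= W.
  have : V <= \sum_j (2 + h * V * (2 * A j / yn 0 j)).
    apply: ler_sum => j _.
    have := dyV j; rewrite wE => dy.
    have : yn 0 j / 2 * `|w j| <= yn 0 j + h * (A j * V).
      apply: (@le_trans _ _ (`|sigma h yn 0 j * w j|)).
        by rewrite (normrM (sigma h yn 0 j)) (gtr0_norm (s0 j)) ler_wpM2r.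
      rewrite -(subrK (yn 0 j) (_ * w j)) (le_trans (ler_normD _ _))//.
      by rewrite addrC (gtr0_norm (y0 j)) lerD2l.
    have yj_gt0 : 0 < 2 / yn 0 j by rewrite divr_gt0.
    move=> /(ler_wpM2l (ltW yj_gt0)).
    have yj_neq0 : yn 0 j != 0 by rewrite gt_eqF.
    have -> : 2 / yn 0 j * (yn 0 j / 2 * `|w j|) = `|w j| by field.
    by move=> /le_trans; apply; rewrite le_eqVlt; apply/orP; left; apply/eqP;
      field.
  rewrite big_split/= sumr_const card_ord -mulr_sumr -/B -mulr_natl /W => Vle.
  have : V * (h * B) <= V * (1 / 2) by exact: ler_wpM2l.
  lra.
(* w_j - 1 = ((ynext_j - yn_j) - (sigma_j - yn_j)) / sigma_j, where both
   differences are of order h and sigma_j >= yn_j / 2. *)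
have w1 j : `|w j - 1| <= D * h.
  have -> : w j - 1 = (ynext h 0 j - sigma h yn 0 j) / sigma h yn 0 j.
    by rewrite mulrBl divff// gt_eqF.
  have dys : `|ynext h 0 j - sigma h yn 0 j| <= (A j * W + c j) * h.
    have -> : ynext h 0 j - sigma h yn 0 j =
      (ynext h 0 j - yn 0 j) - (sigma h yn 0 j - yn 0 j) by ring.
    rewrite (le_trans (ler_normB _ _))// mulrDl lerD//.
    by rewrite (le_trans (dyV j))// mulrC ler_pM2r// ler_wpM2l.
  rewrite normrM normfV (gtr0_norm (s0 j)) ler_pdivrMr//.
  apply: (le_trans dys).
  apply: (@le_trans _ _ ((D * h) * (yn 0 j / 2))); last first.
    by rewrite ler_wpM2l// mulr_ge0 ?sumr_ge0// ltW.
  rewrite mulrAC ler_pM2r//.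
  apply: (@le_trans _ _ ((A j * W + c j) * 2 / yn 0 j * (yn 0 j / 2))).
    rewrite le_eqVlt; apply/orP; left; apply/eqP; field.
    by rewrite gt_eqF.
  rewrite ler_pM2r ?divr_gt0// (le_trans (ler_norm _))//.
  by rewrite /D (bigD1 j)//= lerDl sumr_ge0.
have -> : ynext h 0 i - yn 0 i - h * pds_rhs S i yn =
    h * \sum_k (production S i k yn * (w k - 1)
                - destruction S i k yn * (w i - 1)).
  rewrite step -mulrBr /pds_rhs -sumrB -sumrB; congr (_ * _).
  by apply: eq_bigr => k _; ring.
rewrite normrM gtr0_norm//.
have -> : A i * D * h ^+ 2 = h * (A i * (D * h)) by ring.
by rewrite ler_pM2l// flux_le.
Unshelve. all: by end_near. Qed.

End SchemeExpansion.

(** * The linear exchange system *)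

Section LinearExchange.
Context {R : realType} {N : nat}.
Implicit Types (y z : 'rV[R]_N) (i j : 'I_N).

Lemma is_derive_coord (c : R) i y (v : 'rV[R]_N) :
  is_derive y v (fun z : 'rV[R]_N => c * z 0 i : R) (c * v 0 i).
Proof.
pose f (z : 'rV[R]_N) : R := c * z 0 i.
have quotient : (fun h : R => h^-1 *: ((f \o shift y) (h *: v) - f y)) @ 0^'
    --> (c * v 0 i : R).
  apply: cvg_near_cst; near=> h.
  have h0 : h != 0 by near: h; exact: nbhs_dnbhs_neq.
  by rewrite /f/= !mxE /GRing.scale/=; field.
by split; [apply/cvg_ex; exists (c * v 0 i)|exact: cvg_lim].
Unshelve. all: by end_near. Qed.

Lemma C2_coord (c : R) i : C2_pos_orthant (fun y : 'rV[R]_N => c * y 0 i).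
Proof.
have partialE k : partial k (fun y : 'rV[R]_N => c * y 0 i)
    = fun=> c * (delta_mx 0 k : 'rV[R]_N) 0 i.
  apply/funext => y; rewrite /partial.
  exact: (@derive_val _ _ _ _ _ _ _ (is_derive_coord c i y (delta_mx 0 k))).
move=> y _; split.
  by apply: continuousM; [exact: cst_continuous|exact: coord_continuous].
move=> k; rewrite partialE; split.
- exact: (@ex_derive _ _ _ _ _ _ _ (is_derive_coord c i y (delta_mx 0 k))).
- exact: cst_continuous.
- move=> l; split; first exact: derivable_cst.
  have -> : partial l (fun=> c * (delta_mx 0 k : 'rV[R]_N) 0 i)
    = (fun=> 0) :> ('rV[R]_N -> R).
    by apply/funext => z; rewrite /partial derive_cst.
  exact: cst_continuous.
Qed.

Definition exchange_rate (i j a b : 'I_N) y : R :=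
  (a == i)%:R * (b == j)%:R * y 0 i.

Lemma exchange_rate_ge0 i j a b y : nneg_vec y -> 0 <= exchange_rate i j a b y.
Proof. by move=> y0; rewrite !mulr_ge0. Qed.

(** The test system [y_i' = - y_i], [y_j' = y_i]: constituent [i] decays at unit
    rate into constituent [j] and nothing else happens. *)
Definition exchange i j : pds R N :=
  @Pds R N (fun a b => exchange_rate i j b a) (exchange_rate i j)
    (fun a b => @exchange_rate_ge0 i j b a) (@exchange_rate_ge0 i j)
    (fun a b => @C2_coord _ i) (fun a b => @C2_coord _ i).

Lemma sum_indicator (T : finType) (b0 : T) (g : T -> R) :
  \sum_b (b == b0)%:R * g b = g b0.
Proof.
rewrite (bigD1 b0)//= eqxx mul1r big1 ?addr0// => b /negPf->.
by rewrite mul0r.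
Qed.

(** The weights [w] cover both uses of the flux: [w = 1] gives the right-hand
    side, and [w = ynext / sigma] the increment of the scheme. *)
Lemma exchange_flux i j a y (w : 'I_N -> R) :
  \sum_b (production (exchange i j) a b y * w b
          - destruction (exchange i j) a b y * w a)
  = ((a == j)%:R - (a == i)%:R) * (y 0 i * w i).
Proof.
rewrite sumrB /= /exchange_rate mulrBl; congr (_ - _).
- rewrite -(sum_indicator i (fun b => (a == j)%:R * (y 0 i * w b))).
  by apply: eq_bigr => b _; ring.
- under eq_bigr do rewrite (mulrC (a == i)%:R) -!mulrA.
  rewrite (sum_indicator j (fun=> (a == i)%:R * (y 0 i * w a))).
  by case: eqP => [->|]; rewrite ?mul0r.
Qed.

Lemma exchange_rhs i j a y :
  pds_rhs (exchange i j) a y = ((a == j)%:R - (a == i)%:R) * y 0 i.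
Proof.
rewrite -[y 0 i]mulr1 -(exchange_flux i j a y (fun=> 1)) /pds_rhs -sumrB.
by apply: eq_bigr => b _; rewrite !mulr1.
Qed.

Lemma exchange_conservative i j : i != j -> fully_conservative (exchange i j).
Proof.
move=> /negPf ij a b y _; split; rewrite //= /exchange_rate;
by case: eqP => [->|_]; rewrite ?ij ?(eq_sym j) ?ij ?mulr0 ?mul0r.
Qed.

(** The closed form [y_i = y0_i e^-t], [y_j = y0_j + y0_i (1 - e^-t)], the other
    components being constant. *)
Lemma exchange_solution i j y0 : i != j -> pos_vec y0 ->
  pds_solution (exchange i j) 0 (fun t => \row_a
    (y0 0 a + ((a == j)%:R - (a == i)%:R) * (y0 0 i * (1 - expR (- t))))).
Proof.
move=> /negPf ij y00; split.
  move=> t t0 a; rewrite mxE.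
  have et : expR (- t) <= 1 by rewrite -expR0 ler_expR oppr_le0.
  have e0 := expR_ge0 (- t).
  have := y00 i; have := y00 a.
  case: (eqVneq a i) => [->|ai] ya yi; rewrite ?ij /=.
    rewrite (_ : _ + _ = y0 0 i * expR (- t)); last by ring.
    by rewrite mulr_ge0// ltW.
  rewrite subr0; apply: addr_ge0; first exact: ltW.
  by rewrite !mulr_ge0 ?subr_ge0// ltW.
pose k a : R := (a == j)%:R - (a == i)%:R.
have de t : is_derive t (1 : R) (fun s : R => expR (- s)) (- expR (- t)).
  have := is_derive1_comp (is_derive_expR (- t)) (is_deriveNid t (1 : R)).
  by rewrite mulrN1.
have dy a t : is_derive t (1 : R)
    (fun s => y0 0 a + k a * (y0 0 i * (1 - expR (- s))))
    (k a * (y0 0 i * expR (- t))).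
  have := is_deriveD (is_derive_cst (y0 0 a) t (1 : R))
    (is_deriveZ (k a) (is_deriveZ (y0 0 i)
      (is_deriveB (is_derive_cst (1 : R) t (1 : R)) (de t)))).
  by rewrite /GRing.scale/= add0r sub0r opprK.
have rhsE a t : pds_rhs (exchange i j) a (\row_b
    (y0 0 b + k b * (y0 0 i * (1 - expR (- t)))))
    = k a * (y0 0 i * expR (- t)).
  by rewrite exchange_rhs mxE /k eqxx ij /=; ring.
move=> a; split => [|t t0]; rewrite rhsE; last first.
  apply: (eq_ind _ (fun f : R -> R => is_derive t (1 : R) f _) (dy a t)).
  by apply/funext => s; rewrite mxE.
have [+ <-] := dy a 0; rewrite /derivable /derive => /cvg_dnbhs_at_right.
apply: cvg_trans; apply: near_eq_cvg; apply: nearW => h /=.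
by rewrite !mxE /GRing.scale/= mulr1 addr0 add0r.
Qed.

(** Positivity of an arbitrary solution: [e^t y_i] has zero derivative, so [y_i]
    stays positive, and every other component is nondecreasing because its
    derivative is [0] or [y_i >= 0]. *)
Lemma exchange_positive i j : i != j -> pds_positive (exchange i j).
Proof.
move=> ij y0 y00; split.
  exists (fun t => \row_a
    (y0 0 a + ((a == j)%:R - (a == i)%:R) * (y0 0 i * (1 - expR (- t))))).
  split; first exact: exchange_solution.
  by apply/rowP => a; rewrite mxE oppr0 expR0 subrr !mulr0 addr0.
move=> y yS yE t t0; have [y_ge0 y_ode] := yS.
have y_cont a := solution_continuous (i := a) yS t0.
have y_der a (s : R) : 0 < s -> is_derive s (1 : R) (fun r => y r 0 a)
    (((a == j)%:R - (a == i)%:R) * y s 0 i).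
  by move=> s0; rewrite -exchange_rhs; have [_] := y_ode a; exact.
move=> a; have [->|ai] := eqVneq a i.
- have g_der (s : R) : 0 < s -> is_derive s (1 : R) (fun r => expR r * y r 0 i) 0.
    move=> s0; have yi := y_der i s s0.
    have := is_deriveM (is_derive_expR s) yi.
    rewrite eqxx (negPf ij) /GRing.scale/= => gs.
    by apply: is_derive_eq gs _; ring.
  have [|||s _] := @MVT R (fun r => expR r * y r 0 i) (fun=> 0) 0 t => //.
  + by move=> s; rewrite in_itv/= => /andP[/g_der].
  + move=> s; apply: continuousM; last exact: y_cont.
    by apply: continuous_subspaceT; exact: continuous_expR.
  rewrite mul0r expR0 mul1r yE => /eqP; rewrite subr_eq0 => /eqP gt.
  by rewrite -(pmulr_rgt0 _ (expR_gt0 t)) gt.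
- have [|||s] := @MVT R (fun r => y r 0 a)
    (fun s => ((a == j)%:R - (a == i)%:R) * y s 0 i) 0 t => //.
  + by move=> s; rewrite in_itv/= => /andP[/y_der].
  rewrite in_itv/= => /andP[s0 _] /eqP.
  rewrite subr_eq yE (negPf ai) subr0 => /eqP ->.
  rewrite ltr_wpDl// subr0 !mulr_ge0//; last exact: ltW.
  exact: (y_ge0 s (ltW s0)).
Qed.

(** * Recovering the denominators *)

(** The scheme for the exchange system solved explicitly: its [i]-th equation
    involves [ynext_i] alone and gives
    [ynext_i / sigma_i = yn_i / (sigma_i + h * yn_i)]. *)
Definition exchange_step (sigma : R -> 'rV[R]_N -> 'rV[R]_N) i j
    (yn : 'rV[R]_N) (h : R) : 'rV[R]_N :=
  \row_a (yn 0 a + h * (((a == j)%:R - (a == i)%:R)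
                        * (yn 0 i * (yn 0 i / (sigma h yn 0 i + h * yn 0 i))))).

Lemma exchange_step_ratio (sigma : R -> 'rV[R]_N -> 'rV[R]_N) i j
    (yn : 'rV[R]_N) (h : R) :
  i != j ->
  sigma h yn 0 i + h * yn 0 i != 0 ->
  exchange_step sigma i j yn h 0 i
  = sigma h yn 0 i * (yn 0 i / (sigma h yn 0 i + h * yn 0 i)).
Proof. by move=> /negPf ij s0; rewrite mxE ij eqxx/=; field. Qed.

Lemma exchange_stepP (sigma : R -> 'rV[R]_N -> 'rV[R]_N) i j
    (yn : 'rV[R]_N) (h : R) :
  i != j -> 0 < h -> pos_vec yn -> 0 < sigma h yn 0 i ->
  MPRK_step sigma (exchange i j) h yn (exchange_step sigma i j yn h).
Proof.
move=> ij h0 y0 s0 a.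
have s1 : sigma h yn 0 i + h * yn 0 i != 0.
  by rewrite gt_eqF// addr_gt0// mulr_gt0.
rewrite (exchange_flux i j a yn
  (fun b => exchange_step sigma i j yn h 0 b / sigma h yn 0 b)).
have s2 : sigma h yn 0 i != 0 by rewrite gt_eqF.
rewrite exchange_step_ratio// [X in _ * (_ * (_ * X))](_ : _ =
  yn 0 i / (sigma h yn 0 i + h * yn 0 i)); last by field; rewrite s1.
by rewrite mxE.
Qed.

(** Solving [s * (a - u) = h * a * u] for [s] gives
    [(s - a) * (a - u) = a * ((1 + h) * r - h^2 * a)] with [r = u - a + h * a].
    The right-hand side is of order [h^2] and [a - u] is at least [h * a / 2]. *)
Lemma denominator_bound (s a u h C : R) : 0 < a -> 0 < h -> h <= 1 ->
  C * h <= a / 2 -> s * (a - u) = h * a * u ->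
  `|u - a + h * a| <= C * h ^+ 2 -> `|s - a| <= 2 * (2 * C + a) * h.
Proof.
move=> a0 h0 h1 Ch su uC.
have C0 : 0 <= C.
  by rewrite -(pmulr_lge0 _ (exprn_gt0 2 h0)) (le_trans _ uC).
have au : h * a / 2 <= a - u.
  have : C * h ^+ 2 <= h * (a / 2) by rewrite expr2 mulrA mulrC ler_pM2l.
  by move: uC; rewrite ler_norml; lra.
have au0 : 0 < a - u by apply: lt_le_trans au; rewrite divr_gt0// mulr_gt0.
have E : (s - a) * (a - u) = a * ((1 + h) * (u - a + h * a) - h ^+ 2 * a).
  by rewrite mulrBl su; ring.
have num : `|(1 + h) * (u - a + h * a) - h ^+ 2 * a| <= (2 * C + a) * h ^+ 2.
  apply: le_trans (ler_normB _ _) _; rewrite [leRHS]mulrDl; apply: lerD.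
    have h_ge0 : 0 <= 1 + h by lra.
    by rewrite normrM (ger0_norm h_ge0) -mulrA; apply: ler_pM => //; lra.
  by rewrite ger0_norm 1?mulrC// mulr_ge0// ?exprn_ge0// ltW.
have : `|s - a| * (h * a / 2) <= a * ((2 * C + a) * h ^+ 2).
  apply: (@le_trans _ _ (`|s - a| * (a - u))); first by rewrite ler_wpM2l.
  rewrite -(gtr0_norm au0) -normrM E normrM (gtr0_norm a0).
  by rewrite ler_pM2l.
have -> : a * ((2 * C + a) * h ^+ 2) = 2 * (2 * C + a) * h * (h * a / 2).
  by field.
by rewrite ler_pM2r// divr_gt0// mulr_gt0.
Qed.

Lemma first_order_denominator (sigma : R -> 'rV[R]_N -> 'rV[R]_N) i j yn :
  (forall dt yn, 0 < dt -> pos_vec yn -> pos_vec (sigma dt yn)) ->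
  first_order_accurate sigma -> i != j -> pos_vec yn ->
  (fun dt : R => sigma dt yn 0 i - yn 0 i) =O_ (0^'+) (fun dt : R => dt).
Proof.
move=> sigma0 acc ij y0.
have [[y [yS yE]] _] := exchange_positive ij y0.
have stepP h : 0 < h ->
    MPRK_step sigma (exchange i j) h yn (exchange_step sigma i j yn h).
  by move=> h0; apply: exchange_stepP => //; exact: sigma0.
have [C1 C10 accC] := (bigO_at_rightP _ _).1
  (acc _ (exchange_positive ij) (exchange_conservative ij)
     0 yn y0 y yS yE _ stepP i).
have [|C2 C20 yC] := @solution_expansion _ _ _ _ _ i yS; first by rewrite yE.
pose C := C1 + C2; have C0 : 0 < C by rewrite ltr_pwDl.
apply/bigO_at_rightP; exists (2 * (2 * C + yn 0 i)).
  by rewrite mulr_gt0// addr_gt0// mulr_gt0.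
near=> h.
have h0 : 0 < h by near: h; exact: nbhs_right_gt.
have s0 := sigma0 h yn h0 y0 i.
have s1 : sigma h yn 0 i + h * yn 0 i != 0.
  by rewrite gt_eqF// addr_gt0// mulr_gt0.
rewrite (gtr0_norm h0).
apply: (@denominator_bound _ _ (exchange_step sigma i j yn h 0 i)) => //.
- by near: h; apply: nbhs_right_le.
- rewrite mulrC -ler_pdivlMr//; near: h; apply: nbhs_right_le.
  by rewrite !divr_gt0.
- by rewrite exchange_step_ratio//; field.
- have e1 : `|exchange_step sigma i j yn h 0 i - y (0 + h) 0 i| <= C1 * `|h ^+ 2|.
    by near: h.
  have e2 : `|y (0 + h) 0 i - y 0 0 i - h * pds_rhs (exchange i j) i (y 0)|
      <= C2 * h ^+ 2 by near: h.
  move: e1 e2; rewrite (ger0_norm (exprn_ge0 2 (ltW h0))) yE.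
  rewrite exchange_rhs (negPf ij) eqxx/= !ler_norml /C; lra.
Unshelve. all: by end_near. Qed.

End LinearExchange.

Theorem theorem3p3 (R : realType) (N : nat) (hN : (2 <= N)%N)
    (sigma : R -> 'rV[R]_N -> 'rV[R]_N)
    (sigma_pos : forall (dt : R) (yn : 'rV[R]_N),
       0 < dt -> pos_vec yn -> pos_vec (sigma dt yn)) :
  first_order_accurate sigma <->
  (forall yn : 'rV[R]_N, pos_vec yn -> forall i : 'I_N,
     (fun dt : R => sigma dt yn 0 i - yn 0 i) =O_ (0^'+) (fun dt : R => dt)).
Proof.
split=> [acc yn y0 i|sigmaO S _ _ tn yn y0 y yS yE ynext stepP i].
- have [j ij] : exists j : 'I_N, i != j.
    have [i0|i0] := eqVneq i (Ordinal (ltnW hN)).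
      by exists (Ordinal hN); rewrite i0.
    by exists (Ordinal (ltnW hN)).
  exact: (first_order_denominator sigma_pos acc ij).
- have /choice[c cP] : forall j, exists c, \forall h \near 0^'+,
      `|sigma h yn 0 j - yn 0 j| <= c * h.
    move=> j; have [c c0 cj] := (bigO_at_rightP _ _).1 (sigmaO yn y0 j).
    exists c; near=> h.
    have h0 : 0 < h by near: h; exact: nbhs_right_gt.
    by rewrite -{2}(gtr0_norm h0); near: h.
  have [C1 C10 nextC] := MPRK_expansion i y0 cP stepP.
  have [|C2 C20 yC] := @solution_expansion _ _ _ _ _ i yS; first by rewrite yE.
  apply/bigO_at_rightP; exists (C1 + C2 + 1); first by rewrite ltr_wpDl ?addr_ge0.
  near=> h.
  have h0 : 0 < h by near: h; exact: nbhs_right_gt.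
  have h20 : 0 < h ^+ 2 by exact: exprn_gt0.
  have e1 : `|ynext h 0 i - yn 0 i - h * pds_rhs S i yn| <= C1 * h ^+ 2.
    by near: h.
  have e2 : `|y (tn + h) 0 i - y tn 0 i - h * pds_rhs S i (y tn)| <= C2 * h ^+ 2.
    by near: h.
  move: e1 e2; rewrite (gtr0_norm h20) yE !ler_norml; lra.
Unshelve. all: by end_near. Qed.
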